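(* Let $\kappa$ be a regular uncountable cardinal and $\lambda>\kappa$ a cardinal. Suppose that $\rho\in\mathcal K(\kappa,\lambda)$ and $\rho\ge\overline{\mathfrak d}_\kappa$. Then it is not the case that $I_{\kappa,\lambda}^+\xrightarrow{\kappa}[I_{\kappa,\lambda}^+]^2_\rho$.
   Context: For a cardinal $\mu$ and a set $A$, $P_\mu(A)=\{a\subseteq A:|a|<\mu\}$. $I_{\kappa,\lambda}$ is the set of all $A\subseteq P_\kappa(\lambda)$ such that $A\cap\{b\in P_\kappa(\lambda):a\subseteq b\}=\emptyset$ for some $a\in P_\kappa(\lambda)$; $I_{\kappa,\lambda}^+$ is the set of subsets of $P_\kappa(\lambda)$ not in $I_{\kappa,\lambda}$. $\mathcal K(\kappa,\lambda)$ is the set of all cardinals $\sigma\ge\lambda$ for which there is $T\subseteq P_\kappa(\lambda)$ with $|T|=\sigma$ and $|T\cap P(a)|<\kappa$ for every $a\in P_\kappa(\lambda)$. (In particular $\lambda\in\mathcal K(\kappa,\lambda)$.) $\overline{\mathfrak d}_\kappa$ is the least cardinality of an $X\subseteq{}^\kappa\kappa$ such that for every $g\in{}^\kappa\kappa$ there is $x\in P_\kappa(X)$ with $g(\alpha)<\bigcup_{f\in x}f(\alpha)$ for all $\alpha<\kappa$. For $A\subseteq P_\kappa(\lambda)$, $[A]^2_\kappa=\{(\bigcup(a\cap\kappa),b):a,b\in A,\ \bigcup(a\cap\kappa)<\bigcup(b\cap\kappa)\}$. For a cardinal $\rho$ with $2\le\rho\le\lambda^{<\kappa}$, $I_{\kappa,\lambda}^+\xrightarrow{\kappa}[I_{\kappa,\lambda}^+]^2_\rho$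 means: for every $F:[P_\kappa(\lambda)]^2_\kappa\to\rho$ and every $A\in I_{\kappa,\lambda}^+$ there is $B\in I_{\kappa,\lambda}^+\cap P(A)$ such that $F''[B]^2_\kappa\ne\rho$. *)

(* Defs.v *)
From mathcomp Require Import all_boot all_order.
From mathcomp Require Import all_classical.

Set Implicit Arguments.
Unset Strict Implicit.
Unset Printing Implicit Defensive.

Import Order.TTheory.
Local Open Scope classical_set_scope.
Local Open Scope card_scope.

(* Conventions.  The cardinal lambda is a well-ordered type whose order type is
   an initial ordinal.  An ordinal alpha < lambda is an element of that type,
   and an ordinal <= lambda, taken as the von Neumann set of its predecessors,
   is an initial segment of it.  So kappa < lambda is an element [k : L], with
   set of predecessors [below k], and unions of ordinals are unions of initial
   segments.  A cardinal that matters only through its size (rho, the cardinal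
   d-bar) is any type of that cardinality. *)

Definition card_lt (T U : Type) (A : set T) (B : set U) : Prop :=
  A #<= B /\ ~ (B #<= A).

(* P_mu(A), where mu is the cardinality of M *)
Definition Psmall (T U : Type) (M : set U) (A : set T) : set (set T) :=
  [set a | a `<=` A /\ card_lt a M].

(* |D| is the least cardinality of an X satisfying Q *)
Definition least_card (T : Type) (Q : set T -> Prop) (D : Type) : Prop :=
  (exists X, Q X /\ X #= [set: D]) /\ (forall X, Q X -> [set: D] #<= X).

Section WellOrder.
Context {d : Order.disp_t} {L : orderType d}.
Implicit Types (k : L) (S : set L) (A B : set (set L)).

Definition below k : set L := [set x | (x < k)%O].

(* For an initial segment S of a well-order: the ordinal S is a cardinal *)
Definition is_cardinal S : Prop := forall x, S x -> card_lt (below x) S.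

(* no unbounded subset of the infinite cardinal S has fewer than |S| elements *)
Definition regular_cardinal S : Prop :=
  [/\ infinite_set S, is_cardinal S &
      forall C : set L, C `<=` S ->
        (forall y, S y -> exists2 x, C x & (y <= x)%O) -> ~ card_lt C S].

(* P_kappa(lambda) *)
Definition Pkl k : set (set L) := Psmall (below k) [set: L].

(* I_{kappa,lambda} *)
Definition Ikl k : set (set (set L)) :=
  [set A | A `<=` Pkl k /\
           exists2 a, Pkl k a & A `&` [set b | Pkl k b /\ a `<=` b] = set0].

(* I^+_{kappa,lambda} *)
Definition Ikl_pos k : set (set (set L)) :=
  [set A | A `<=` Pkl k /\ ~ Ikl k A].

(* |rho| belongs to K(kappa,lambda) *)
Definition calK k (rho : Type) : Prop :=
  [set: L] #<= [set: rho] /\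
  exists T : set (set L),
    [/\ T `<=` Pkl k, T #= [set: rho] &
        forall a, Pkl k a -> card_lt (T `&` [set b | b `<=` a]) (below k)].

(* The condition defining d-bar: g(alpha) < \bigcup_(f in x) f(alpha) is
   membership of the ordinal g(alpha) in the union of the ordinals f(alpha). *)
Definition dbar_family k (X : set (below k -> below k)) : Prop :=
  forall g : below k -> below k,
    exists2 x, Psmall (below k) X x &
      forall alpha, (\bigcup_(f in x) below (val (f alpha))) (val (g alpha)).

Definition is_dbar k (D : Type) : Prop := least_card (@dbar_family k) D.

(* the ordinal \bigcup (a \cap kappa) *)
Definition Ucap k (a : set L) : set L := \bigcup_(x in a `&` below k) below x.

(* [A]^2_kappa; for ordinals as initial segments, < is proper inclusion *)
Definition pairs k A : set (set L * set L) :=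
  [set p | exists a b, [/\ A a, A b, Ucap k a `<` Ucap k b & p = (Ucap k a, b)]].

(* I^+ --kappa--> [I^+]^2_rho.  The colourings are total functions, of which
   only the restrictions to [P_kappa(lambda)]^2_kappa matter; this is harmless
   for nonempty rho, since every function on that set then extends. *)
Definition partition_arrow k (rho : Type) : Prop :=
  forall F : set L * set L -> rho,
  forall A, Ikl_pos k A ->
    exists B, [/\ Ikl_pos k B, B `<=` A & F @` pairs k B <> [set: rho]].

End WellOrder.

(* Main.v *)
(* Let [T = {t i | i in rho}] witness [rho \in K(kappa, lambda)], let [X] be a
   family as in the definition of d-bar, and code its members injectively by
   elements of [rho].  A point [b] of P_kappa(lambda) knows the set [idx b] of
   the fewer than kappa many [i] with [t i] inside [b], hence the function
   [h b] : kappa -> kappa bounding all members of [X] coded in [idx b].  By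
   regularity there are pairwise disjoint blocks ]p i, h b (p i)], one for each
   [i] in [idx b]; the pair [(S, b)] gets the colour [i] when the ordinal [S]
   lies in the block of [i].  Let [A] be the set of those [b] for which the
   supremum of [b \cap kappa] lies beyond all blocks.  If [B], contained in
   [A], is cofinal, choose [g] so that every ]alpha, g alpha] contains the
   supremum of some [a \cap kappa] with [a] in [B].  Any [b] in [B] with enough
   codes in [idx b] satisfies [g < h b], so each of its blocks is hit, and
   every colour is attained.

   For [A] to be cofinal, [b] must be extendable by large elements of kappa
   without changing [idx b].  So each [t i] is first moved along an injection
   [phi] of lambda into itself whose range misses cofinally many elements of
   kappa. *)

Require Import Defs.
From mathcomp Require Import all_boot all_order.
From mathcomp Require Import wochoice all_classical.

Local Open Scope classical_set_scope.
Local Open Scope card_scope.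

Set Implicit Arguments.
Unset Strict Implicit.
Unset Printing Implicit Defensive.

Import Order.TTheory.

(** * Cardinal comparison through injective functions *)

Lemma card_le_injfun (T U : Type) (A : set T) (B : set U) (u : U) :
  A #<= B ->
  exists f : T -> U, {in A &, injective f} /\ forall x, A x -> B (f x).
Proof.
elim/Ppointed: U => U in B u *; first by case: (no u).
case/pcard_leP=> f; exists f; split; first exact: inj.
by move=> x Ax; apply: funS.
Qed.

Lemma injfun_card_le (T U : Type) (A : set T) (B : set U) (f : T -> U) :
  {in A &, injective f} -> (forall x, A x -> B (f x)) -> A #<= B.
Proof.
move=> fI fAB; rewrite -(card_le_eql (inj_card_eq fI)).
by apply: subset_card_le => _ [x Ax <-]; apply: fAB.
Qed.

(** * Recursion along a well-order and comparability of cardinals *)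

Section WellOrdered.
Context {d : Order.disp_t} {L : orderType d}.
Hypothesis L_wo : well_order (<=%O : rel L).

Lemma wo_least (S : set L) x :
  S x -> exists2 z, S z & forall y, S y -> (z <= y)%O.
Proof.
move=> Sx; have [|z [[Sz minz] _]] := @L_wo (fun y => `[< S y >]).
  by exists x; apply/asboolP.
exists z; first exact/asboolP.
by move=> y Sy; apply: minz; apply/asboolP.
Qed.

Lemma lt_well_founded : well_founded (fun x y : L => (x < y)%O).
Proof.
move=> x; apply: contrapT => nx.
have [z nz zmin] := @wo_least [set y | ~ Acc (fun x y : L => (x < y)%O) y] x nx.
apply: nz; split=> y yz; apply: contrapT => /zmin.
by rewrite leNgt yz.
Qed.

(** [Q] relates an earlier value to a later one: distinctness yields enumerations, [h a <= b] yields
    widely spaced points. *)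
Lemma wf_recursion (P : set L) (Q : L -> L -> Prop) (D : set L) :
    (forall x (f : L -> L), D x ->
      (forall y, D y -> (y < x)%O -> P (f y)) ->
      exists2 v, P v & forall y, D y -> (y < x)%O -> Q (f y) v) ->
  exists f : L -> L, forall x, D x ->
    P (f x) /\ forall y, D y -> (y < x)%O -> Q (f y) (f x).
Proof.
move=> step.
pose R x (g : forall y, (y < x)%O -> L) v :=
  P v /\ forall y (yx : (y < x)%O), D y -> Q (g y yx) v.
pose F x g := xget x (R x g).
have [f fE] : exists f, forall x, f x = F x (fun y _ => f y).
  exists (Fix lt_well_founded (fun=> L) F) => x; rewrite Fix_eq// => y g g' gg'.
  by congr F; apply: functional_extensionality_dep => z; apply: funext => ?.
exists f; apply: (well_founded_ind lt_well_founded) => x IH Dx.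
have [|v Pv Qv] := step x f Dx; first by move=> y Dy yx; case: (IH y yx Dy).
rewrite (fE x) /F; case: xgetP => [w _ [Pw Qw]|/(_ v)[]].
  by split=> // y Dy yx; apply: Qw.
by split=> // y yx Dy; apply: Qv.
Qed.

(* Enumerate [A] without repetition in [B]; if this gets stuck, [B] has been
   exhausted. *)
Lemma card_le_total (A B : set L) : A #<= B \/ B #<= A.
Proof.
have [BA|BA] := pselect (B #<= A); [by right | left].
have [x f Dx _|f fP] := @wf_recursion B (fun a b => a <> b) A.
  apply: contrapT => nov; apply: BA.
  apply: (card_le_trans _ (card_image_le f A)); apply: subset_card_le => v Bv.
  apply: contrapT => nv; apply: nov; exists v => // y Dy _ fy.
  by apply: nv; exists y.
apply: (@injfun_card_le _ _ _ _ f) => [x y|x /fP[]//].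
move=> /set_mem Ax /set_mem Ay fxy.
have [[_ Qx] [_ Qy]] := (fP _ Ax, fP _ Ay).
by case: (ltgtP x y) => // [xy|yx]; [case: (Qy x) | case: (Qx y)].
Qed.

(** * Sets with fewer than kappa elements *)

Section Regular.
Variable k : L.
Hypothesis k_reg : regular_cardinal (below k).

(** The negative form applies to sets in any type, while comparability is proved only for subsets of
    [L]. *)
Definition small (T : Type) (U : set T) := ~ (below k #<= U).

Lemma card_le_small (T U : Type) (A : set T) (B : set U) :
  A #<= B -> small B -> small A.
Proof. by move=> AB nB /card_le_trans /(_ AB). Qed.

Lemma small_sub (T : Type) (A B : set T) : A `<=` B -> small B -> small A.
Proof. by move=> /subset_card_le /card_le_small; apply. Qed.

Lemma small_image (T U : Type) (f : T -> U) (A : set T) :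
  small A -> small (f @` A).
Proof. exact/card_le_small/card_image_le. Qed.

Lemma small_finite (T : Type) (A : set T) : finite_set A -> small A.
Proof. by case: k_reg => kinf _ _ fA /card_le_finite /(_ fA). Qed.

Lemma PklP (b : set L) : Pkl k b <-> small b.
Proof.
split=> [[_ []]//|sb]; split=> //; split=> //.
by have [//|/sb] := card_le_total b (below k).
Qed.

Lemma small_bounded (T : Type) (f : T -> L) (A : set T) :
  small A -> (forall a, A a -> (f a < k)%O) ->
  exists2 y, (y < k)%O & forall a, A a -> (f a < y)%O.
Proof.
move=> sA fk; apply: contrapT => nb.
have [_ _ /(_ (f @` A))] := k_reg.
have fAk : f @` A `<=` below k by move=> _ [a Aa <-]; apply: fk.
apply=> // [y yk|]; last first.
  by split; [apply: subset_card_le | apply: small_image].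
apply: contrapT => ny; apply: nb; exists y => // a Aa.
by rewrite ltNge; apply/negP => yfa; apply: ny; exists (f a) => //; exists a.
Qed.

Lemma small_below x : (x < k)%O -> small (below x).
Proof. by move=> xk; have [_ /(_ _ xk)[]] := k_reg. Qed.

Lemma k_limit x : (x < k)%O -> exists2 y, (y < k)%O & (x < y)%O.
Proof.
move=> xk; have [|_ ->//|y yk xy] := @small_bounded _ id [set x].
  exact/small_finite/finite_set1.
by exists y => //; apply: xy.
Qed.

(* If [k] injected into the union, the preimages of the pieces would be bounded
   in [k], by fewer than [k] many bounds. *)
Lemma small_bigcup (T : Type) (I : set T) (F : T -> set L) :
  small I -> (forall i, I i -> small (F i)) -> small (\bigcup_(i in I) F i).
Proof.
move=> sI sF /(card_le_injfun k)[j [jI jF]].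
pose G i := below k `&` (j @^-1` F i).
have /choice[y yP] : forall i, exists y, I i ->
    (y < k)%O /\ forall x, G i x -> (x < y)%O.
  move=> i; have [Ii|nIi] := pselect (I i); last by exists k.
  have [||y yk yG] := @small_bounded _ id (G i).
  - apply: card_le_small (sF i Ii); apply: (injfun_card_le (f := j)).
      move=> x x' /set_mem[xk _] /set_mem[x'k _].
      by apply: jI; apply/mem_set.
    by move=> x [].
  - by move=> x [].
  by exists y.
have [i Ii|z zk yz] := @small_bounded _ y I sI; first by case: (yP i Ii).
have [i Ii jzi] := jF z zk.
have [yk Gy] := yP i Ii.
by have := lt_trans (Gy z (conj zk jzi)) (yz i Ii); rewrite ltxx.
Qed.

Lemma small_setU (A B : set L) : small A -> small B -> small (A `|` B).
Proof.
move=> sA sB; rewrite -bigcup2inE; apply: small_bigcup => [|[|[|n]] //= _].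
exact/small_finite/finite_II.
Qed.

Hypothesis k_uncountable : ~ countable (below k).

Lemma small_countable (T : Type) (A : set T) : countable A -> small A.
Proof. by move=> cA kA; apply: k_uncountable; apply: sub_countable cA. Qed.

(* The shift is the successor map on [k]; it misses the limit ordinals, which
   are cofinal in [k] because [k] is uncountable and regular. *)
Lemma cofinally_missing_injection : exists phi : L -> L, injective phi /\
  forall x, (x < k)%O ->
    exists z, [/\ (z < k)%O, (x < z)%O & forall y, phi y <> z].
Proof.
have /choice[suc sucP] : forall x, exists y, (x < k)%O ->
    [/\ (y < k)%O, (x < y)%O & forall z, (x < z)%O -> (y <= z)%O].
  move=> x; have [xk|xk] := pselect (x < k)%O; last by exists k.
  have [y yk xy] := k_limit xk.
  have [z xz zmin] := @wo_least (fun z => (x < z)%O) y xy.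
  by exists z => _; split=> //; apply: le_lt_trans (zmin _ xy) yk.
pose phi x := if (x < k)%O then suc x else x.
have phi_neq x y : (x < y)%O -> phi x <> phi y.
  move=> xy; rewrite /phi; case: ifP => xk; case: ifP => yk.
  - have [_ _ /(_ _ xy) sxy] := sucP x xk; have [_ ysy _] := sucP y yk.
    by move=> e; have := le_lt_trans sxy ysy; rewrite e ltxx.
  - by have [sk _ _] := sucP x xk => e; rewrite -e sk in yk.
  - by rewrite (lt_trans xy yk) in xk.
  - by move=> e; rewrite e ltxx in xy.
exists phi; split=> [x y e|x xk].
  case: (ltgtP x y) => // [xy|yx]; first by case: (phi_neq x y).
  by case: (phi_neq y x).
have itk n : (iter n suc x < k)%O.
  by elim: n => [//|n IH] /=; have [] := sucP _ IH.
have [|//|w wk itw] :=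
    @small_bounded _ (fun n => iter n suc x) [set: nat].
- exact/small_countable/countableP.
(* [z] is the supremum of the iterates of [suc] from [x]. If [suc y = z], then [y] is at most some
   iterate, so [z] is at most the next one, which is below [z]. *)
have [|z itz zmin] := @wo_least (fun z => forall n, (iter n suc x < z)%O) w.
  by move=> n; apply: itw.
have zk : (z < k)%O by apply: le_lt_trans wk; apply: zmin => n; apply: itw.
exists z; split=> //; first exact: (itz 0).
move=> y; rewrite /phi; case: ifP => yk e; last by rewrite e zk in yk.
have [_ ysy sy_least] := sucP y yk.
have [n] : exists n, (y <= iter n suc x)%O.
  apply: contrapT => nex; have /zmin : forall n, (iter n suc x < y)%O.
    by move=> n; rewrite ltNge; apply/negP => yn; apply: nex; exists n.
  by rewrite leNgt -e ysy.
rewrite le_eqVlt => /orP[/eqP yE|/sy_least].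
  by have := itz n.+1; rewrite /= -yE e ltxx.
by rewrite e leNgt itz.
Qed.

(** Recursion along kappa puts each point beyond [h] of all earlier ones, by regularity; an
    injection into kappa then indexes the points by [s]. *)
Lemma small_separated (T : Type) (s : set T) (h : L -> L) :
    small s -> s #<= below k -> (forall x, (x < k)%O -> (h x < k)%O) ->
  exists p : T -> L, (forall i, s i -> (p i < k)%O) /\
    forall i j, s i -> s j -> i <> j ->
      (h (p i) <= p j)%O \/ (h (p j) <= p i)%O.
Proof.
move=> ss /(card_le_injfun k)[e [eI ek]] hk.
have [x f xk fk|q qP] :=
    @wf_recursion (below k) (fun a b => (h a <= b)%O) (below k).
  have [y yx|v vk vh] := @small_bounded _ (h \o f) _ (small_below xk).
    exact/hk/fk/yx/lt_trans/xk.
  by exists v => // y _ yx; apply/ltW/vh.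
exists (q \o e); split=> [i si|i j si sj ij]; first by case: (qP _ (ek i si)).
have [[_ qi] [_ qj]] := (qP _ (ek i si), qP _ (ek j sj)).
case: (ltgtP (e i) (e j)) => eij.
- by left; apply: qj => //; apply: ek.
- by right; apply: qi => //; apply: ek.
- by case: ij; apply: eI eij; apply/mem_set.
Qed.

Lemma Ucap_mem (a : set L) x y :
  a y -> (y < k)%O -> (x < y)%O -> Ucap k a x.
Proof. by move=> ay yk xy; exists y. Qed.

Lemma Ucap_bounded (a : set L) :
  small a -> exists2 y, (y < k)%O & Ucap k a `<=` below y.
Proof.
move=> sa; have [||y yk ay] := @small_bounded _ id (a `&` below k).
- exact: small_sub sa.
- by move=> x [].
by exists y => // x [z zak /lt_trans]; apply; apply: ay.
Qed.

(** Regularity at each argument; outside kappa, [h] takes the dummy value [k]. *)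
Lemma small_sup (X : set (below k -> below k)) : small X ->
  exists h : L -> L, (forall x, (x < k)%O -> (h x < k)%O) /\
    forall f a, X f -> (val (f a) < h (val a))%O.
Proof.
move=> sX.
have /choice[h hP] : forall x, exists y, (x < k)%O ->
    (y < k)%O /\ forall f a, X f -> val a = x -> (val (f a) < y)%O.
  move=> x; have [xk|xk] := pselect (x < k)%O; last by exists k.
  pose a : below k := SigSub (mem_set (xk : below k x)).
  have [f _|y yk fy] := @small_bounded _ (fun f => val (f a)) X sX.
    exact: (set_valP (f a)).
  exists y => _; split=> // f b Xf bx.
  by rewrite (_ : b = a); [apply: fy | apply: val_inj].
exists h; split=> [x /hP[]//|f a Xf].
by have [] := hP (val a) (set_valP a); move=> _; apply.
Qed.

End Regular.
End WellOrdered.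

Theorem theorem14p2 (d : Order.disp_t) (lambda : orderType d) (kappa : lambda)
    (rho : Type) (dbar : Type)
    (lambda_wo : well_order (<=%O : rel lambda))
    (lambda_card : is_cardinal [set: lambda])
    (kappa_regular : regular_cardinal (below kappa))
    (kappa_uncountable : ~ countable (below kappa))
    (rho_calK : calK kappa rho)
    (dbarP : is_dbar kappa dbar)
    (dbar_le_rho : [set: dbar] #<= [set: rho]) :
  ~ partition_arrow kappa rho.
Proof.
have [lambda_le_rho [T [T_Pkl T_rho T_small]]] := rho_calK.
have [[X [X_dom X_dbar]] _] := dbarP.
(* [r0] will be the colour of the pairs that meet no block. *)
have [r0 _] : [set: rho] !=set0.
  apply/set0P/negP => /eqP rho0; move: lambda_le_rho; rewrite rho0.
  by move/card_le0P => /seteqP[/(_ kappa Logic.I)].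
have [t [tI tT]] : exists t : rho -> set lambda,
    {in [set: rho] &, injective t} /\ forall i, [set: rho] i -> T (t i).
  by apply: (card_le_injfun set0); move: T_rho; rewrite card_eq_le => /andP[].
have [c [cI _]] : exists c : (below kappa -> below kappa) -> rho,
    {in X &, injective c} /\ forall f, X f -> [set: rho] (c f).
  apply: (card_le_injfun r0); apply: card_le_trans dbar_le_rho.
  by move: X_dbar; rewrite card_eq_le => /andP[].
have [phi [phiI phi_miss]] :=
  cofinally_missing_injection lambda_wo kappa_regular kappa_uncountable.
pose idx (b : set lambda) := [set i | phi @` t i `<=` b].
(* Since [phi] is injective, the preimage of [b] is small, and it contains [t i] for every [i] in
   [idx b]. *)
have idx_small b : small kappa b ->
    small kappa (idx b) /\ idx b #<= below kappa.
  move=> sb.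
  have [|le_k sTb] := T_small (phi @^-1` b).
    apply/(PklP lambda_wo); apply: card_le_small sb.
    by apply: (injfun_card_le (f := phi)) => // x y _ _; apply: phiI.
  have le_Tb : idx b #<= T `&` [set a | a `<=` phi @^-1` b].
    apply: (injfun_card_le (f := t)) => [i j _ _|i ib].
      by apply: tI; apply: mem_setT.
    by split=> [|x tx]; [apply: tT | apply: ib; exists x].
  by split; [apply: card_le_small sTb | apply: card_le_trans le_k].
pose spec (s : set rho) (hp : (lambda -> lambda) * (rho -> lambda)) :=
  let: (h, p) := hp in
  [/\ forall x, (x < kappa)%O -> (h x < kappa)%O,
      forall f a, X f -> s (c f) -> (val (f a) < h (val a))%O,
      forall i, s i -> (p i < kappa)%O
    & forall i j, s i -> s j -> i <> j ->
        (h (p i) <= p j)%O \/ (h (p j) <= p i)%O].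
(* The choice depends on the index set alone, so enlarging [b] without changing [idx b] keeps its
   blocks. *)
have /choice[H HP] :
    forall s, exists hp, small kappa s /\ s #<= below kappa -> spec s hp.
  move=> s; have [[ss s_le]|ns] := pselect (small kappa s /\ s #<= below kappa);
    last by exists (id, fun=> kappa).
  have [|h [hk hX]] :=
      @small_sup _ _ _ kappa_regular (X `&` c @^-1` s).
    apply: card_le_small ss; apply: (injfun_card_le (f := c)) => [f g|f []//].
    by move=> /set_mem[Xf _] /set_mem[Xg _]; apply: cI; apply: mem_set.
  have [p [pk p_sep]] := small_separated lambda_wo kappa_regular ss s_le hk.
  by exists (h, p) => _; split=> // f a Xf sf; apply: hX.
pose h b := (H (idx b)).1; pose p b := (H (idx b)).2.
have hpP b : small kappa b -> spec (idx b) (h b, p b).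
  by move=> /idx_small /HP; rewrite /h /p; case: (H _).
(* For an ordinal [S], this says [p b i < S <= h b (p b i)]. *)
pose block b i :=
  [set S : set lambda | S (p b i) /\ S `<=` below (h b (p b i))].
have /choice[F FP] : forall q : set lambda * set lambda, exists i, forall j,
    idx q.2 j -> block q.2 j q.1 -> idx q.2 i /\ block q.2 i q.1.
  move=> q; have [[i qi]|nq] :=
      pselect (exists i, idx q.2 i /\ block q.2 i q.1); first by exists i.
  by exists r0 => j jq Sj; case: nq; exists j.
have F_eq b i S : small kappa b -> idx b i -> block b i S -> F (S, b) = i.
  move=> sb ib Si; have [/= jb Sj] := FP (S, b) i ib Si.
  apply: contrapT => ij; have [_ _ _ /(_ _ i jb ib ij)] := hpP b sb.
  case: Si Sj => [Spi Shi] [Spj Shj]; case.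
    by rewrite leNgt => /negP; apply; apply: Shj.
  by rewrite leNgt => /negP; apply; apply: Shi.
pose A := [set b | small kappa b /\ exists y,
  [/\ b y, (y < kappa)%O & forall i, idx b i -> (h b (p b i) < y)%O]].
move=> /(_ F A)[|B [B_pos BA]].
  split=> [b [sb _]|[_ [a /(PklP lambda_wo)sa /seteqP[/(_ _)A0 _]]]].
    exact/(PklP lambda_wo).
  have [hk _ pk _] := hpP a sa.
  have [||y yk yh] :=
      @small_bounded _ _ _ kappa_regular _ (fun i => h a (p a i)) (idx a).
  - by case: (idx_small a sa).
  - by move=> i /pk/hk.
  have [z [zk yz zphi]] := phi_miss y yk.
  have idxE : idx (a `|` [set z]) = idx a.
    apply/seteqP; split=> i ia x xt; last by left; apply: ia.
    by case: (ia x xt) => // xz; case: xt xz => x' _ <- /zphi.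
  have saz : small kappa (a `|` [set z]).
    by apply: small_setU => //; apply: small_finite => //; apply: finite_set1.
  apply: (A0 (a `|` [set z])); split; last first.
    by split; [apply/(PklP lambda_wo) | move=> x ax; left].
  split=> //; exists z; split=> [|//|i]; first by right.
  rewrite /h /p idxE => /yh /lt_trans; apply.
  exact: yz.
apply; apply/seteqP; split=> // i _.
have B_cofinal a : small kappa a -> exists2 b, B b & a `<=` b.
  move=> sa; apply: contrapT => nb; case: B_pos => B_Pkl; apply.
  split=> //; exists a; first exact/(PklP lambda_wo).
  apply/seteqP; split=> // b [Bb [_ ab]]; apply: nb.
  by exists b.
have /choice[g gP] : forall x : below kappa, exists y : below kappa,
    exists a, [/\ B a, Ucap kappa a (val x) & Ucap kappa a `<=` below (val y)].
  (* [Ucap kappa a] contains [x] only if [a] has an element of kappa strictly above [x], hence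
     [z]. *)
  move=> x; have [z zk xz] := k_limit kappa_regular (set_valP x).
  have [|a Ba za] := B_cofinal [set z].
    by apply: small_finite => //; apply: finite_set1.
  have [sa _] := BA a Ba.
  have [y yk ay] := Ucap_bounded kappa_regular sa.
  exists (SigSub (mem_set (yk : below kappa y))), a; split=> //.
  by apply: Ucap_mem xz => //; apply: za.
have [x [xX [_ sx]] xg] := X_dom g.
have t_small j : small kappa (phi @` t j).
  by apply: small_image; apply/(PklP lambda_wo)/T_Pkl/tT.
(* [b] is to have in [idx b] both the wanted colour [i] and the codes of all members of [x], which
   puts [g] below [h b]. *)
have [|b Bb xb] := B_cofinal
    (phi @` t i `|` \bigcup_(f in x) phi @` t (c f)).
  by apply: small_setU => //; apply: small_bigcup.
have [sb [y [yb yk hy]]] := BA b Bb.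
have [hk hX pk _] := hpP b sb.
have ib : idx b i by move=> u tu; apply: xb; left.
pose q : below kappa := SigSub (mem_set (pk i ib : below kappa (p b i))).
have [a [Ba aq ag]] := gP q.
have [f fx gf] := xg q.
have ah : Ucap kappa a `<=` below (h b (p b i)).
  move=> u /ag ug; apply: lt_trans ug _; apply: lt_trans gf _.
  apply: (hX f q); first exact: xX.
  by move=> v tv; apply: xb; right; exists f.
exists (Ucap kappa a, b); last exact: F_eq.
exists a, b; split=> //; split.
  move=> u /ah uh; apply: (Ucap_mem yb yk).
  exact: lt_trans uh (hy i ib).
(* The inclusion is proper: [h b (p b i)] lies in [Ucap kappa b], but not in [Ucap kappa a]. *)
move=> /(_ _ (Ucap_mem yb yk (hy i ib)))/ah.
by rewrite /below /= ltxx.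
Qed.
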